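(* Let $\mu$ be the standard Gaussian measure on $\mathbb{R}$. Let $\{X_n\}_{n\geq 1}$ be a sequence of real valued, independent and identically distributed random variables with zero mean and unit variance. Suppose that the common law of the $X_n$'s is absolutely continuous with respect to $\mu$, with a density (with respect to $\mu$) belonging to $\mathcal{L}^2(\mathbb{R},\mathcal{B}(\mathbb{R}),\mu)$. Let $Z$ be a standard Gaussian random variable which is independent of the sequence $\{X_n\}_{n\geq 1}$. Then, for any sequence $\{b_n\}_{n\geq 1}$ of non-negative real numbers such that $$\lim_{n\to+\infty}\frac{b_n}{n}=0\quad\text{and}\quad \lim_{n\to+\infty}\frac{b_n}{n^{2/3}}=+\infty,$$ the density with respect to $\mu$ of (the law of) the random variable $$\sqrt{\frac{n}{n+b_n}}\cdot\frac{X_1+\cdots+X_n}{\sqrt{n}}+\sqrt{\frac{b_n}{n+b_n}}\cdot Z$$ converges in $\mathcal{L}^1(\mathbb{R},\mathcal{B}(\mathbb{R}),\mu)$ to the constant function $1$ as $n$ tends to infinity.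
   Context: The standard Gaussian measure $\mu$ on $\mathbb{R}$ is $\mu(A)=\int_A \frac{1}{\sqrt{2\pi}}\exp\{-x^2/2\}\,dx$ for $A\in\mathcal{B}(\mathbb{R})$, where $\mathcal{B}(\mathbb{R})$ is the Borel $\sigma$-algebra. The density of a random variable with respect to $\mu$ means the Radon–Nikodym derivative of its law with respect to $\mu$. *)

(* Defs.v *)
From HB Require Import structures.
From mathcomp Require Import all_boot all_order all_algebra finmap.
From mathcomp Require Import all_classical all_reals all_analysis measurable_realfun.

Set Implicit Arguments.
Unset Strict Implicit.
Unset Printing Implicit Defensive.

Import Order.TTheory GRing.Theory Num.Theory.
Import numFieldNormedType.Exports.

Local Open Scope classical_set_scope.
Local Open Scope ring_scope.
Local Open Scope charge_scope.

Section independence.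
Context d d' (T : measurableType d) (T' : measurableType d') (R : realType).
Variable P : probability T R.

Definition mutually_independent (I : choiceType) (X : I -> {mfun T >-> T'}) :=
  forall (J : {fset I}) (B : I -> set T'),
    (forall i, i \in J -> measurable (B i)) ->
    P (\bigcap_(i in [set` J]) (X i @^-1` B i)) =
      (\prod_(i <- J) P (X i @^-1` B i))%E.

Definition identically_distributed (I : Type) (X : I -> {mfun T >-> T'}) :=
  forall (i j : I) (B : set T'), measurable B ->
    distribution P (X i) B = distribution P (X j) B.

Definition sigma_of_family (I : Type) (X : I -> {mfun T >-> T'}) :
    set (set T) :=
  <<s \bigcup_(i in [set: I]) preimage_set_system setT (X i) measurable >>.

Definition independent_of_family (I : Type) (X : I -> {mfun T >-> T'})
    (Z : {mfun T >-> T'}) :=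
  forall (A : set T) (B : set T'), sigma_of_family X A -> measurable B ->
    P (A `&` Z @^-1` B) = (P A * P (Z @^-1` B))%E.

End independence.

Section gaussian.
Variable R : realType.

(* [normal_prob 0 1] as a probability on the canonical measurable type of [R],
   in which real random variables take their values; the library only declares
   it on [measurableTypeR R], whose measurable sets are the same. *)
Definition gaussian : set R -> \bar R := normal_prob 0 1.

Let gaussian0 : gaussian set0 = 0%E.
Proof. exact: (measure0 (normal_prob (0 : R) 1)). Qed.

Let gaussian_ge0 A : (0 <= gaussian A)%E.
Proof. exact: (measure_ge0 (normal_prob (0 : R) 1)). Qed.

Let gaussian_sigma_additive : semi_sigma_additive gaussian.
Proof.
exact: (@measure_semi_sigma_additive _ _ _ (normal_prob (0 : R) 1)).
Qed.

HB.instance Definition _ := isMeasure.Build _ R R gaussian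
  gaussian0 gaussian_ge0 gaussian_sigma_additive.

Let gaussian_setT : gaussian [set: R] = 1%E.
Proof. exact: (probability_setT (normal_prob (0 : R) 1)). Qed.

HB.instance Definition _ :=
  @Measure_isProbability.Build _ R R gaussian gaussian_setT.

Definition standard_gaussian d (T : measurableType d) (P : probability T R)
    (Z : {RV P >-> R}) :=
  forall B : set R, measurable B -> distribution P Z B = gaussian B.

End gaussian.
Arguments gaussian R _ : clear implicits.

(* Real-valued version of the library's Radon-Nikodym derivative, which is
   everywhere finite when [nu `<< mu]; it is meaningless (constantly 0)
   otherwise. *)
Definition density d (T : measurableType d) (R : realType)
    (mu : {sigma_finite_measure set T -> \bar R})
    (nu : {finite_measure set T -> \bar R}) : T -> R :=
  fine \o ('d (charge_of_finite_measure nu) '/d mu).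

Section smoothed_sum.
Context d (T : measurableType d) (R : realType) (P : probability T R).
Variables (X : nat -> {RV P >-> R}) (Z : {RV P >-> R}) (b : nat -> R) (n : nat).

(* [X i] is the variable written X_(i+1) when counting from 1. *)
Definition smoothed_sum (t : T) : R :=
  Num.sqrt (n%:R / (n%:R + b n)) * ((\sum_(i < n) X i t) / Num.sqrt n%:R) +
  Num.sqrt (b n / (n%:R + b n)) * Z t.

Let measurable_smoothed_sum : measurable_fun setT smoothed_sum.
Proof.
apply: measurable_funD; apply: measurable_funM => //.
by apply: measurable_funM => //; apply: measurable_sum => i; exact: measurable_funPT.
Qed.

HB.instance Definition _ :=
  @isMeasurableFun.Build _ _ _ _ smoothed_sum measurable_smoothed_sum.

End smoothed_sum.

(* Main.v *)
Require Import Defs.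
From HB Require Import structures.
From mathcomp Require Import all_boot all_order all_algebra finmap.
From mathcomp Require Import all_classical all_reals all_analysis.
From mathcomp Require Import measurable_realfun ring lra.

Set Implicit Arguments.
Unset Strict Implicit.
Unset Printing Implicit Defensive.

Import Order.TTheory GRing.Theory Num.Theory.
Import numFieldNormedType.Exports.

Local Open Scope classical_set_scope.
Local Open Scope ring_scope.

(** The proof is Lindeberg's replacement method, in total variation.

Write [nu] for the law of the summands, [gamma] for the standard Gaussian law,
[b] for [b n] and [s] for [sqrt b]. The smoothed sum is
[(S + s Z) / sqrt (n + b)] with [S] the sum of [n] independent variables of law
[nu], whereas [gamma] is the law of the same expression when the summands are
Gaussian. The first is turned into the second by exchanging the summands one at
a time. During each exchange the Gaussian noise [s Z] is available as a
mollifier: if [h] takes its values in [0, 1] then [H x = E h (y + x + s Z)]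
equals a polynomial of degree two in [x] up to an error [C |x| ^ 3 / s ^ 3],
where [C] depends neither on [h] nor on [y] ([smear_gaussian_taylor]). As [nu]
and [gamma] have the same first two moments, exchanging one summand changes the
expectation of [h] by at most [C (E |X| ^ 3 + E |G| ^ 3) / s ^ 3]
([smear_standardized]); the other summands can only average this error. After
[n] exchanges the total variation distance is [O(n b ^ (- 3 / 2))]
([lindeberg]), which tends to zero because [b / n ^ (2 / 3)] tends to infinity
([lindeberg_rate_le]).

Smoothness of [H] comes from the Cameron-Martin formula
[E k (u + G) = E (k (G) exp (u G - u ^ 2 / 2))], which moves the shift from the
rough function [k] to an entire function of [u]
([ge0_integral_gaussian_shift], [gaussian_tilt_taylor]). The third moment of
[nu] is finite because its density [f] is square integrable:
[|x| ^ 3 f <= x ^ 6 + f ^ 2] ([integrable_normX_of_density_Lfun2]).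

Finally the [L^1] distance from a density to [1] is at most twice the supremum
over Borel sets of the difference of the two laws ([Lnorm_density_le]). *)

(** * Affine changes of variable under the Gaussian law *)

Section affine_change_of_variables.
Local Open Scope ereal_scope.
Context {R : realType} (m s : R).
Hypothesis s0 : (0 < s)%R.
Local Notation leb := (@lebesgue_measure R).

Let aff : measurableTypeR R -> measurableTypeR R := fun x => (m + s * x)%R.

Let measurable_aff : measurable_fun setT aff.
Proof. by apply: measurable_funD => //; exact: measurable_funM. Qed.

Let s_ge0 : (0 <= s)%R. Proof. exact: ltW. Qed.

Lemma lebesgue_measure_affine (A : set R) : measurable A ->
  leb A = s%:E * leb ((fun x => m + s * x)%R @^-1` A).
Proof.
move=> mA.
apply: (lebesgue_measure_unique (mu := mscale (NngNum s_ge0)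
  (pushforward leb aff))) => // _ [[a b]] _ <-.
transitivity (s%:E * leb (aff @^-1` `]a, b]%classic)); last by [].
have -> : aff @^-1` `]a, b] = `]((a - m) / s)%R, ((b - m) / s)%R]%classic.
  apply/seteqP; split => x /=; rewrite !in_itv/= /aff;
    by rewrite ltr_pdivrMr// ler_pdivlMr// [(x * s)%R]mulrC ltrBlDl lerBrDl//.
rewrite !lebesgue_measure_itv/= !lte_fin ltr_pM2r ?invr_gt0// ltrD2r.
case: ifP => _; last by rewrite mule0.
rewrite -!EFinD -EFinM; congr EFin.
by field; rewrite gt_eqF.
Qed.

Lemma ge0_integral_lebesgue_affine (f : R -> \bar R) :
  measurable_fun setT f -> (forall x, 0 <= f x) ->
  \int[leb]_x f x = s%:E * \int[leb]_x f (m + s * x)%R.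
Proof.
move=> mf f0.
rewrite (eq_measure_integral (mscale (NngNum s_ge0) (pushforward leb aff)))//;
  last first.
  by move=> A mA _; rewrite [LHS]lebesgue_measure_affine.
by rewrite ge0_integral_mscale//= (ge0_integral_pushforward measurable_aff).
Qed.

End affine_change_of_variables.

Section gaussian_affine.
Local Open Scope ereal_scope.
Context {R : realType}.
Local Notation leb := (@lebesgue_measure R).
Local Notation gamma := (gaussian R).

Lemma measurable_affine (m s : R) :
  measurable_fun setT (fun x : R => (m + s * x)%R).
Proof. by apply: measurable_funD => //; exact: measurable_funM. Qed.

Lemma emeasurable_normal_pdf (m s : R) :
  measurable_fun setT (fun x : R => (normal_pdf m s x)%:E).
Proof. by apply/measurable_EFinP; exact: measurable_normal_pdf. Qed.

Lemma ge0_integral_gaussian (f : R -> \bar R) :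
  measurable_fun setT f -> (forall x, 0 <= f x) ->
  \int[gamma]_x f x = \int[leb]_x (f x * (normal_pdf 0 1 x)%:E).
Proof.
move=> mf f0.
have dom : (normal_prob (0 : R) 1) `<< leb by exact: normal_prob_dominates.
transitivity (\int[normal_prob (0 : R) 1]_x f x).
  (* both laws coincide, but live on two measurable types: transport by id *)
  have mid : measurable_fun setT (idfun : measurableTypeR R -> R).
    by move=> _ A mA; rewrite setTI.
  rewrite (eq_measure_integral
    (pushforward (normal_prob (0 : R) 1) (idfun : measurableTypeR R -> R)))//.
  by rewrite (ge0_integral_pushforward mid).
rewrite -(Radon_Nikodym_SigmaFinite.change_of_variables dom f0)//.
have mpdf := emeasurable_normal_pdf 0 1.
have mRN : measurable_fun setT
    (Radon_Nikodym_SigmaFinite.f (normal_prob (0 : R) 1) leb).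
  exact: measurable_int (Radon_Nikodym_SigmaFinite.f_integrable dom).
apply: ae_eq_integral => //.
- exact: emeasurable_funM.
- exact: emeasurable_funM.
apply: ae_eqe_mul2l.
apply: integral_ae_eq => //.
  exact: Radon_Nikodym_SigmaFinite.f_integrable.
by move=> E _ mE; rewrite -Radon_Nikodym_SigmaFinite.f_integral.
Qed.

(** Reduces affine changes of variable under the Gaussian law to a pointwise
comparison of normal densities. *)
Lemma ge0_integral_gaussian_affine (m s : R) (f : R -> \bar R) : (0 < s)%R ->
  measurable_fun setT f -> (forall x, 0 <= f x) ->
  \int[gamma]_x f (m + s * x)%R = \int[leb]_x (f x * (normal_pdf m s x)%:E).
Proof.
move=> s0 mf f0.
have mfa : measurable_fun setT (fun x : R => f (m + s * x)%R).
  by apply: measurableT_comp => //; exact: measurable_affine.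
have mpa : measurable_fun setT (fun x : R => (normal_pdf m s (m + s * x))%:E).
  apply: (measurableT_comp (emeasurable_normal_pdf m s)).
  exact: measurable_affine.
rewrite (ge0_integral_gaussian mfa (fun=> f0 _)).
have mfp : measurable_fun setT (fun x : R => f x * (normal_pdf m s x)%:E).
  exact: (emeasurable_funM mf (emeasurable_normal_pdf m s)).
have fp0 (x : R) : 0 <= f x * (normal_pdf m s x)%:E.
  by rewrite mule_ge0// lee_fin normal_pdf_ge0.
rewrite (ge0_integral_lebesgue_affine m s0 mfp fp0).
rewrite -ge0_integralZl//=; last 2 first.
- exact: (emeasurable_funM mfa mpa).
- by rewrite lee_fin ltW.
apply: eq_integral => x _; rewrite muleCA -EFinM; congr (_ * _%:E).
rewrite !normal_pdfE ?oner_eq0 ?gt_eqF// /normal_peak /normal_fun mulrA.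
congr (_ * expR _)%R; last by field; rewrite gt_eqF.
rewrite expr1n mul1r -mulrnAr sqrtrM ?sqr_ge0// sqrtr_sqr gtr0_norm//.
by rewrite invfM mulrA divff ?mul1r// gt_eqF.
Qed.

End gaussian_affine.

(** * Normal densities relative to the Gaussian law *)

Section gaussian_calculus.
Local Open Scope ereal_scope.
Context {R : realType}.
Local Notation leb := (@lebesgue_measure R).
Local Notation gamma := (gaussian R).

(** The density of [N(m, s ^+ 2)] with respect to [N(0, 1)]: working relatively
to the Gaussian law keeps every integral over one probability space. *)
Definition normal_density (m s x : R) : R :=
  (s^-1 * expR (x ^+ 2 / 2 - (x - m) ^+ 2 / (s ^+ 2 *+ 2)))%R.

(** The case [s = 1], in the form that generates the Hermite polynomials. *)
Definition gaussian_tilt (u x : R) : R := expR (u * x - u ^+ 2 / 2).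

Lemma normal_densityE (m s x : R) : (0 < s)%R ->
  normal_pdf m s x = (normal_density m s x * normal_pdf 0 1 x)%R.
Proof.
move=> s0; rewrite !normal_pdfE ?oner_eq0 ?gt_eqF// /normal_density /normal_fun.
rewrite mulrACA -expRD; congr (_ * expR _)%R; last by field; rewrite gt_eqF.
rewrite /normal_peak expr1n mul1r -mulrnAr sqrtrM ?sqr_ge0// sqrtr_sqr.
by rewrite gtr0_norm// invfM.
Qed.

Lemma normal_density_ge0 (m s x : R) : (0 < s)%R ->
  (0 <= normal_density m s x)%R.
Proof. by move=> s0; rewrite mulr_ge0 ?expR_ge0// invr_ge0 ltW. Qed.

Lemma gaussian_tilt_ge0 (u x : R) : (0 <= gaussian_tilt u x)%R.
Proof. exact: expR_ge0. Qed.

Lemma normal_density1 (u x : R) : normal_density u 1 x = gaussian_tilt u x.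
Proof.
by rewrite /normal_density invr1 mul1r; congr expR; field.
Qed.

Lemma measurable_normal_density2 (y s : R) :
  measurable_fun setT (fun p : R * R => normal_density (y + p.1) s p.2).
Proof.
apply: measurable_funM => //; apply: measurableT_comp => //.
apply: measurable_funB; apply: measurable_funM => //.
  by apply: measurable_funX.
apply: measurable_funX; apply: measurable_funB => //.
by apply: measurable_funD.
Qed.

Lemma measurable_normal_density (m s : R) :
  measurable_fun setT (normal_density m s).
Proof.
apply: measurable_funM => //; apply: measurableT_comp => //.
apply: measurable_funB; apply: measurable_funM => //.
by apply: measurable_funX; apply: measurable_funB.
Qed.

Lemma measurable_gaussian_tilt (u : R) : measurable_fun setT (gaussian_tilt u).
Proof.
by rewrite (_ : gaussian_tilt u = normal_density u 1);
  [exact: measurable_normal_density|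
  apply/funext => x; rewrite normal_density1].
Qed.

Lemma ge0_integral_gaussian_density (m s : R) (f : R -> \bar R) : (0 < s)%R ->
  measurable_fun setT f -> (forall x, 0 <= f x) ->
  \int[gamma]_x f (m + s * x)%R =
  \int[gamma]_x (f x * (normal_density m s x)%:E).
Proof.
move=> s0 mf f0.
have mfd : measurable_fun setT (fun x : R => f x * (normal_density m s x)%:E).
  apply: emeasurable_funM => //.
  by apply/measurable_EFinP; exact: measurable_normal_density.
have fd0 (x : R) : 0 <= f x * (normal_density m s x)%:E.
  by rewrite mule_ge0// lee_fin normal_density_ge0.
rewrite (ge0_integral_gaussian mfd fd0)
  (ge0_integral_gaussian_affine m s0 mf f0).
by apply: eq_integral => x _; rewrite -muleA -EFinM -normal_densityE.
Qed.

(** The Cameron-Martin formula. *)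
Lemma ge0_integral_gaussian_shift (u : R) (f : R -> \bar R) :
  measurable_fun setT f -> (forall x, 0 <= f x) ->
  \int[gamma]_x f (u + x)%R = \int[gamma]_x (f x * (gaussian_tilt u x)%:E).
Proof.
move=> mf f0; transitivity (\int[gamma]_x f (u + 1 * x)%R).
  by apply: eq_integral => x _; rewrite mul1r.
rewrite (ge0_integral_gaussian_density u ltr01 mf f0).
by apply: eq_integral => x _; rewrite normal_density1.
Qed.

Lemma integral_gaussian_tilt (u : R) :
  \int[gamma]_x (gaussian_tilt u x)%:E = 1.
Proof.
have := @ge0_integral_gaussian_shift u (cst 1) (measurable_cst _) (fun=> lee01).
rewrite integral_cst//= probability_setT mule1 => ->//.
by apply: eq_integral => x _; rewrite mul1e.
Qed.

(** The affine image of [gamma] has a density with respect to [gamma] itself. *)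
Lemma gaussian_preimage_affine_null (m s : R) (A : set R) : (0 < s)%R ->
  measurable A -> gamma A = 0 ->
  gamma ((fun x => m + s * x)%R @^-1` A) = 0.
Proof.
move=> s0 mA A0.
have mpre : measurable ((fun x => m + s * x)%R @^-1` A).
  by rewrite -[X in measurable X]setTI; exact: measurable_affine.
have mI : measurable_fun setT (fun x : R => (\1_A x : R)%:E).
  exact/measurable_EFinP/measurable_indic.
have I0 (x : R) : 0 <= (\1_A x : R)%:E by rewrite lee_fin.
transitivity (\int[gamma]_x (\1_A (m + s * x)%R : R)%:E).
  rewrite (_ : (fun x : R => _) =
      EFin \o \1_((fun x => m + s * x)%R @^-1` A))//.
  by rewrite integral_indic// setIT.
rewrite (ge0_integral_gaussian_density m s0 mI I0).
have -> : (fun x : R => (\1_A x)%:E * (normal_density m s x)%:E) =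
          (fun x => (normal_density m s x)%:E) \_ A.
  by apply/funext => x; rewrite patchE indicE; case: ifP; rewrite ?mul1e ?mul0e.
rewrite -integral_mkcond; apply: null_set_integral => //.
by apply/measurable_EFinP/measurable_funTS; exact: measurable_normal_density.
Qed.

(** Completing the square: for independent [N(0, 1)] variables [G] and [Z], the
joint density of [(G, y + G + s Z)] at [(x, v)] is the density of the second
component times the conditional density of the first, which is again normal. *)
Lemma normal_densityM (y s x v : R) : (0 < s)%R ->
  (normal_density (y + x) s v =
   normal_density y (Num.sqrt (1 + s ^+ 2)) v *
   normal_density ((v - y) / (1 + s ^+ 2)) (s / Num.sqrt (1 + s ^+ 2)) x)%R.
Proof.
move=> s0.
have q0 : (0 < 1 + s ^+ 2)%R by rewrite ltr_pwDl// sqr_ge0.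
have rs0 : (0 < Num.sqrt (1 + s ^+ 2))%R by rewrite sqrtr_gt0.
rewrite /normal_density mulrACA -expRD.
congr (_ * expR _)%R; first by field; rewrite !gt_eqF.
rewrite expr_div_n sqr_sqrtr ?(ltW q0)//.
by field; rewrite !gt_eqF.
Qed.

Lemma integral_normal_density (m s : R) : (0 < s)%R ->
  \int[gamma]_x (normal_density m s x)%:E = 1.
Proof.
move=> s0.
have := @ge0_integral_gaussian_density m s (cst 1) s0 (measurable_cst _)
  (fun=> lee01).
rewrite integral_cst//= probability_setT mule1 => ->//.
by apply: eq_integral => x _; rewrite mul1e.
Qed.

Lemma ge0_integral_gaussian_convolution (y s : R) (h : R -> \bar R) :
  (0 < s)%R -> measurable_fun setT h -> (forall x, 0 <= h x) ->
  \int[gamma]_x \int[gamma]_z h (y + x + s * z)%R =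
  \int[gamma]_z h (y + Num.sqrt (1 + s ^+ 2) * z)%R.
Proof.
move=> s0 mh h0.
have q0 : (0 < 1 + s ^+ 2)%R by rewrite ltr_pwDl// sqr_ge0.
have rs0 : (0 < Num.sqrt (1 + s ^+ 2))%R by rewrite sqrtr_gt0.
rewrite (ge0_integral_gaussian_density y rs0 mh h0).
under eq_integral do rewrite (ge0_integral_gaussian_density _ s0 mh h0).
have mJ : measurable_fun setT
    (fun p : R * R => h p.2 * (normal_density (y + p.1) s p.2)%:E).
  apply: emeasurable_funM; first exact: measurableT_comp.
  by apply/measurable_EFinP; exact: measurable_normal_density2.
have J0 (p : R * R) : 0 <= h p.2 * (normal_density (y + p.1) s p.2)%:E.
  by rewrite mule_ge0// lee_fin normal_density_ge0.
rewrite (fubini_tonelli _ mJ J0)/=.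
apply: eq_integral => v _.
under eq_integral do rewrite normal_densityM// EFinM muleA.
rewrite ge0_integralZl//.
- by rewrite integral_normal_density ?mule1// divr_gt0.
- by apply/measurable_EFinP; exact: measurable_normal_density.
- by move=> x _; rewrite lee_fin normal_density_ge0// divr_gt0.
- by rewrite mule_ge0// lee_fin normal_density_ge0.
Qed.

End gaussian_calculus.

(** * Taylor expansion of the Gaussian tilt *)

Section taylor.
Context {R : realType}.
Local Notation gamma := (gaussian R).

(** Comparison of the tail of the exponential series with the whole series,
using [k`! <= (k + 3)`!]. *)
Lemma expR_taylor2 (s : R) :
  `|expR s - (1 + s + s ^+ 2 / 2)| <= `|s| ^+ 3 * expR `|s|.
Proof.
have seriesE n : series (exp_coeff s) (n + 3)%N =
    (1 + s + s ^+ 2 / 2) + \sum_(k < n) exp_coeff s (k + 3)%N.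
  rewrite /series/= big_mkord addnC big_split_ord/= !big_ord_recl big_ord0.
  rewrite !exp_coeffE/= /bump/= !fact0 expr0 expr1 !factS fact0.
  congr (_ + _); last by apply: eq_bigr => i _; rewrite addnC.
  by rewrite !muln1 invr1 !mul1r addr0 mulrC addrA.
have le_n n : `|series (exp_coeff s) (n + 3)%N - (1 + s + s ^+ 2 / 2)| <=
    `|s| ^+ 3 * expR `|s|.
  rewrite seriesE addrAC subrr add0r (le_trans (ler_norm_sum _ _ _))//.
  apply: (@le_trans _ _ (`|s| ^+ 3 * series (exp_coeff `|s|) n)).
    rewrite /series/= big_mkord mulr_sumr ler_sum// => k _.
    rewrite /exp_coeff/= normrM normrX exprD [X in X * _ <= _]mulrC -mulrA.
    rewrite !ler_wpM2l ?exprn_ge0// ger0_norm ?invr_ge0//.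
    rewrite lef_pV2 ?posrE ?ltr0n ?fact_gt0// ler_nat leq_fact// leq_addr//.
  rewrite ler_wpM2l ?exprn_ge0// /expR.
  apply: nondecreasing_cvgn_le; last exact: is_cvg_series_exp_coeff.
  by apply: nondecreasing_series => i _ _; exact: exp_coeff_ge0.
have : `|series (exp_coeff s) (n + 3)%N - (1 + s + s ^+ 2 / 2)| @[n --> \oo] -->
    `|expR s - (1 + s + s ^+ 2 / 2)|.
  apply: cvg_norm; apply: cvgB; last exact: cvg_cst.
  rewrite (cvg_shiftn 3); exact: is_cvg_series_exp_coeff.
by move=> /cvgr_to_le; apply; near=> n; exact: le_n.
Unshelve. all: by end_near.
Qed.

(** An integrable weight that dominates [expR (2 * `|w|)], hence all powers of
[`|w|]; writing it with tilts makes its integral immediate. *)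
Definition tilt_envelope (w : R) : R :=
  gaussian_tilt 2 w + gaussian_tilt (- 2) w.

Lemma tilt_envelope_ge0 w : 0 <= tilt_envelope w.
Proof. by rewrite addr_ge0// gaussian_tilt_ge0. Qed.

Lemma expR_le_tilt_envelope (w : R) :
  expR (2 * `|w|) <= expR 2 * tilt_envelope w.
Proof.
rewrite mulrDr /gaussian_tilt -!expRD.
have -> : 2 + (2 * w - 2 ^+ 2 / 2) = 2 * w by field.
have -> : 2 + (- 2 * w - (- 2) ^+ 2 / 2) = 2 * - w by field.
by case: (ger0P w) => _; rewrite ?lerDl ?lerDr expR_ge0.
Qed.

Lemma normrX_le_tilt_envelope (w : R) n :
  `|w| ^+ n.+1 <= n.+1`!%:R * expR 2 * tilt_envelope w.
Proof.
rewrite -mulrA; apply: (@le_trans _ _ (n.+1`!%:R * expR `|w|)).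
  rewrite -ler_pdivrMl ?ltr0n ?fact_gt0// mulrC.
  by apply: le_trans (expR_ge1Dxn n (normr_ge0 w)); rewrite lerDr.
rewrite ler_wpM2l// (le_trans _ (expR_le_tilt_envelope w))// ler_expR.
by rewrite mulr2n mulrDl mul1r lerDl.
Qed.

Definition taylor_cst : R := 7 * expR 3.

Lemma taylor_cst_ge0 : 0 <= taylor_cst.
Proof. by rewrite mulr_ge0// expR_ge0. Qed.

(** Second order expansion of the tilt at [u = 0], with Hermite polynomials as
coefficients. For [`|u| > 1] the polynomial part is itself [O(`|u| ^+ 3)], which
is why one bound serves all [u]. *)
Lemma gaussian_tilt_taylor (u w : R) :
  `|gaussian_tilt u w - (1 + w * u + (w ^+ 2 - 1) / 2 * u ^+ 2)| <=
  `|u| ^+ 3 * (gaussian_tilt u w + taylor_cst * tilt_envelope w).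
Proof.
(* for [`|u| <= 1], [`|u| * t] bounds the exponent [`|u * w - u ^+ 2 / 2|] *)
set t := `|w| + 2^-1.
have t0 : 0 <= t by rewrite addr_ge0.
have Et : expR (2 * t) <= expR 3 * tilt_envelope w.
  have -> : 2 * t = 1 + 2 * `|w| by rewrite /t; field.
  have -> : (3 : R) = 1 + 2 by ring.
  by rewrite [expR (1 + 2)]expRD expRD -mulrA ler_wpM2l ?expR_ge0//
    expR_le_tilt_envelope.
have {}Et : 7 * expR (2 * t) <= taylor_cst * tilt_envelope w.
  by rewrite /taylor_cst -mulrA ler_wpM2l.
have e1 : 1 + 2 * t <= expR (2 * t) by exact: expR_ge1Dx.
have e2 : 1 + (2 * t) ^+ 2 / 2 <= expR (2 * t).
  by have := @expR_ge1Dxn R (2 * t) 1; rewrite mulr_ge0//; exact.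
have n2 : `|2^-1 : R| = 2^-1 by rewrite ger0_norm.
have n8 : `|8^-1 : R| = 8^-1 by rewrite ger0_norm.
have G0 : 0 <= gaussian_tilt u w := gaussian_tilt_ge0 u w.
have [u1|u1] := leP `|u| 1; last first.
  have u3 : 1 <= `|u| ^+ 3 by rewrite exprn_ege1// ltW.
  have u31 : `|u| <= `|u| ^+ 3 by rewrite -[leLHS]expr1 ler_weXn2l// ltW.
  have u32 : `|u| ^+ 2 <= `|u| ^+ 3 by rewrite ler_weXn2l// ltW.
  rewrite (le_trans (ler_normB _ _))// mulrDr lerD//.
    by rewrite ger0_norm// ler_peMl.
  apply: (@le_trans _ _ (`|u| ^+ 3 * (1 + `|w| + (`|w| ^+ 2 + 1) / 2))).
    rewrite !mulrDr mulr1 (le_trans (ler_normD _ _))// lerD//.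
      rewrite (le_trans (ler_normD _ _))// normr1 lerD// normrM mulrC.
      by rewrite ler_wpM2r.
    rewrite normrM normrX [leRHS]mulrC ler_pM//.
    rewrite normrM n2 ler_wpM2r//.
    by rewrite (le_trans (ler_normB _ _))// normrX normr1.
  rewrite ler_wpM2l ?exprn_ge0//; apply: le_trans Et.
  have wt : `|w| = t - 2^-1 by rewrite /t addrK.
  rewrite wt; nra.
set s := u * w - u ^+ 2 / 2.
have -> : gaussian_tilt u w - (1 + w * u + (w ^+ 2 - 1) / 2 * u ^+ 2) =
    (expR s - (1 + s + s ^+ 2 / 2)) + u ^+ 3 * (u / 8 - w / 2).
  by rewrite /gaussian_tilt -/s /s; field.
rewrite (le_trans (ler_normD _ _))//.
have sle : `|s| <= `|u| * t.
  have q : `|u ^+ 2 / 2| = `|u| ^+ 2 / 2 by rewrite normrM normrX n2.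
  rewrite /s /t mulrDr (le_trans (ler_normB _ _))// q normrM lerD//.
  by rewrite ler_wpM2r// expr2 ler_piMl.
have slet : `|s| <= t by rewrite (le_trans sle)// ler_piMl.
have t3 : t ^+ 3 <= 6 * expR t.
  have := @expR_ge1Dxn R t 2 t0; rewrite -lerBrDl => h.
  rewrite -ler_pdivrMl// mulrC (le_trans h)// lerBlDr lerDl//.
rewrite [leRHS]mulrDr -[leLHS]add0r lerD ?mulr_ge0 ?exprn_ge0//.
apply: (@le_trans _ _ (`|u| ^+ 3 * (6 * expR (2 * t)) +
  `|u| ^+ 3 * expR (2 * t))).
  apply: lerD.
    rewrite (le_trans (expR_taylor2 s))//.
    apply: (@le_trans _ _ ((`|u| * t) ^+ 3 * expR t)).
      by rewrite ler_pM ?exprn_ge0 ?expR_ge0 ?ler_expR//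
        lerXn2r ?nnegrE ?mulr_ge0.
    rewrite exprMn -mulrA ler_wpM2l ?exprn_ge0//.
    have -> : 2 * t = t + t by ring.
    by rewrite [expR (t + t)]expRD mulrA ler_wpM2r ?expR_ge0.
  rewrite normrM normrX ler_wpM2l ?exprn_ge0//.
  rewrite (le_trans (ler_normB _ _))// !normrM n2 n8.
  have wt : `|w| = t - 2^-1 by rewrite /t addrK.
  rewrite wt; nra.
rewrite -mulrDr ler_wpM2l ?exprn_ge0// (le_trans _ Et)//.
by lra.
Qed.

Lemma integrable_gaussian_tilt (u : R) :
  gamma.-integrable setT (EFin \o gaussian_tilt u).
Proof.
apply/integrableP; split; first by apply/measurable_EFinP;
  exact: measurable_gaussian_tilt.
under eq_integral do rewrite /= ger0_norm ?gaussian_tilt_ge0//.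
by rewrite /= integral_gaussian_tilt ltry.
Qed.

Lemma Rintegral_gaussian_tilt (u : R) : \int[gamma]_w gaussian_tilt u w = 1.
Proof. by rewrite /Rintegral integral_gaussian_tilt. Qed.

Lemma integrable_tilt_envelope : gamma.-integrable setT (EFin \o tilt_envelope).
Proof.
have := integrableD measurableT (integrable_gaussian_tilt 2)
  (integrable_gaussian_tilt (- 2)).
by apply: eq_integrable.
Qed.

Lemma Rintegral_tilt_envelope : \int[gamma]_w tilt_envelope w = 2.
Proof.
rewrite RintegralD//; [|exact: integrable_gaussian_tilt..].
by rewrite !Rintegral_gaussian_tilt.
Qed.

Lemma integrable_gaussian_normX n :
  gamma.-integrable setT (fun w : R => (`|w| ^+ n)%:E).
Proof.
case: n => [|n].
  under eq_fun do rewrite expr0.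
  by apply: finite_measure_integrable_cst.
apply: (le_integrable measurableT (g := fun w =>
  (n.+1`!%:R * expR 2 * tilt_envelope w)%:E)).
- by apply/measurable_EFinP; apply: measurable_funX.
- move=> w _ /=; rewrite lee_fin [leLHS]ger0_norm ?exprn_ge0//
    [leRHS]ger0_norm ?normrX_le_tilt_envelope//.
  by rewrite !mulr_ge0// ?expR_ge0 ?tilt_envelope_ge0.
- under eq_fun do rewrite EFinM.
  exact: (integrableZl measurableT _ integrable_tilt_envelope).
Qed.

Lemma integrable_gaussian_X n :
  gamma.-integrable setT (fun w : R => (w ^+ n)%:E).
Proof.
apply: (le_integrable measurableT (g := fun w : R => (`|w| ^+ n)%:E)).
- by apply/measurable_EFinP; apply: measurable_funX.
- by move=> w _ /=; rewrite lee_fin !normrX normr_id.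
- exact: integrable_gaussian_normX.
Qed.

End taylor.

(** * Averaging a test function against a law *)

Section smearing.
Context {R : realType}.
Local Notation gamma := (gaussian R).
Implicit Types (m : probability R R) (h k : R -> R).

Lemma Rintegral_probability_cst d (T : measurableType d)
  (P : probability T R) (r : R) : \int[P]_x r = r.
Proof.
rewrite Rintegral_cst//.
have -> : fine (P setT) = 1 by rewrite probability_setT.
by rewrite mulr1.
Qed.

(** The class contains the indicators of Borel sets, and unlike them it is
stable under averaging over translates. *)
Definition test_function h := measurable_fun setT h /\ forall x, 0 <= h x <= 1.

Lemma test_function_affine h (y s : R) : test_function h ->
  test_function (fun x => h (y + s * x)).
Proof.
move=> [mh h01]; split => [|x]; last exact: h01.
by apply: measurableT_comp => //; exact: measurable_affine.
Qed.

Lemma test_function_normr_le1 h x : test_function h -> `|h x| <= 1.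
Proof. by move=> [_ /(_ x)/andP[h0 h1]]; rewrite ger0_norm. Qed.

Lemma integrable_test_functionM m h k : test_function h ->
  m.-integrable setT (EFin \o k) ->
  m.-integrable setT (fun x => (h x * k x)%:E).
Proof.
move=> th ik; apply: (le_integrable measurableT _ _ ik).
  apply/measurable_EFinP; apply: measurable_funM; first by case: th.
  by apply/measurable_EFinP; exact: measurable_int ik.
by move=> x _ /=; rewrite lee_fin normrM ler_piMl// test_function_normr_le1.
Qed.

Lemma integrable_test_function m h : test_function h ->
  m.-integrable setT (EFin \o h).
Proof.
move=> th; have := integrable_test_functionM th
  (finite_measure_integrable_cst m 1 measurableT).
by apply: eq_integrable => // x _ /=; rewrite mulr1.
Qed.

Definition smear m (s : R) h (y : R) : R := \int[m]_x h (y + s * x).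

Lemma smearE m s h y : test_function h ->
  (smear m s h y)%:E = (\int[m]_x (h (y + s * x))%:E)%E.
Proof.
move=> th; rewrite /smear /Rintegral fineK//; apply: integrable_fin_num => //.
exact: (integrable_test_function _ (test_function_affine y s th)).
Qed.

Lemma test_function_smear m s h : test_function h ->
  test_function (smear m s h).
Proof.
move=> th; split.
  apply/measurable_EFinP.
  rewrite (_ : _ \o _ = fun y => (\int[m]_x (h (y + s * x))%:E)%E); last first.
    by apply/funext => y; rewrite /= smearE.
  apply: (@measurable_fun_fubini_tonelli_F _ _ _ _ _ m
    (fun p : R * R => (h (p.1 + s * p.2))%:E)) => /=.
    apply/measurable_EFinP; apply: measurableT_comp; first by case: th.
    by apply: measurable_funD => //; apply: measurable_funM.
  by move=> p; rewrite lee_fin; case: th => _ /(_ (p.1 + s * p.2))/andP[].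
move=> y; have ih := integrable_test_function m (test_function_affine y s th).
apply/andP; split.
  by apply: Rintegral_ge0 => x _; case: th => _ /(_ (y + s * x))/andP[].
have -> : 1 = \int[m]_x (1 : R).
  by rewrite Rintegral_probability_cst.
apply: le_Rintegral => //; first exact: finite_measure_integrable_cst.
by move=> x _; case: th => _ /(_ (y + s * x))/andP[].
Qed.

Lemma smear_contraction m s (f g : R -> R) (e : R) :
  test_function f -> test_function g -> (forall x, `|f x - g x| <= e) ->
  forall y, `|smear m s f y - smear m s g y| <= e.
Proof.
move=> tf tg fg y.
have fi := integrable_test_function m (test_function_affine y s tf).
have gi := integrable_test_function m (test_function_affine y s tg).
have fgi : m.-integrable setT
    (EFin \o (fun x => f (y + s * x) - g (y + s * x))).
  by have := integrableB measurableT fi gi; apply: eq_integrable.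
rewrite /smear -RintegralB// (le_trans (le_normr_Rintegral _ _))//.
apply: (@le_trans _ _ (\int[m]_x e)).
  apply: le_Rintegral => //; first exact: integrable_norm.
  exact: finite_measure_integrable_cst.
by rewrite Rintegral_probability_cst.
Qed.

(** Adding further independent summands does not increase an error. *)
Lemma iter_smear_contraction m s (f g : R -> R) (e : R) n :
  test_function f -> test_function g -> (forall x, `|f x - g x| <= e) ->
  forall y, `|iter n (smear m s) f y - iter n (smear m s) g y| <= e.
Proof.
move=> tf tg fg.
have ti i h : test_function h -> test_function (iter i (smear m s) h).
  by move=> th; elim: i => //= i; exact: test_function_smear.
elim: n => //= n ih y; apply: smear_contraction => //; exact: ti.
Qed.

(** Variances of independent Gaussian variables add up. *)
Lemma smear_gaussian_gaussian (s : R) h y : 0 < s -> test_function h ->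
  smear gamma 1 (smear gamma s h) y = smear gamma (Num.sqrt (1 + s ^+ 2)) h y.
Proof.
move=> s0 th; apply: EFin_inj; rewrite !smearE//;
  last exact: test_function_smear.
have [mh h01] := th.
rewrite -(@ge0_integral_gaussian_convolution _ y s (EFin \o h))//; last 2 first.
- exact/measurable_EFinP.
- by move=> x; rewrite lee_fin; case/andP: (h01 x).
by apply: eq_integral => x _; rewrite smearE// mul1r.
Qed.

End smearing.

(** * Lindeberg replacement *)

Section lindeberg.
Context {R : realType}.
Local Notation gamma := (gaussian R).
Implicit Types (m : probability R R) (h k : R -> R).

Definition smear_cst : R := 1 + 2 * taylor_cst.

Lemma smear_cst_ge0 : 0 <= smear_cst.
Proof. by rewrite addr_ge0 ?mulr_ge0 ?taylor_cst_ge0. Qed.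

(** The coefficients are Hermite coefficients of [k]; the error term does not
involve [k] because the expansion is that of the tilt. *)
Lemma gaussian_shift_taylor k u : test_function k ->
  `|\int[gamma]_w k (u + w) -
    (\int[gamma]_w k w + (\int[gamma]_w (k w * w)) * u +
     (\int[gamma]_w (k w * ((w ^+ 2 - 1) / 2))) * u ^+ 2)| <=
  smear_cst * `|u| ^+ 3.
Proof.
move=> tk; have [mk k01] := tk.
have i0 : gamma.-integrable setT (EFin \o k) by exact: integrable_test_function.
have i1 : gamma.-integrable setT (EFin \o (fun w => k w * w)).
  by apply: integrable_test_functionM => //;
    have := @integrable_gaussian_X R 1; apply: eq_integrable.
have iq : gamma.-integrable setT (EFin \o (fun w : R => (w ^+ 2 - 1) / 2)).
  have i2 := integrableB measurableT (@integrable_gaussian_X R 2)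
    (@integrable_gaussian_X R 0).
  have := integrableZl measurableT (2^-1) i2.
  by apply: eq_integrable => // w _ /=; rewrite -EFinB -EFinM expr0 mulrC.
have i2 : gamma.-integrable setT (EFin \o (fun w => k w * ((w ^+ 2 - 1) / 2))).
  exact: integrable_test_functionM.
have it : gamma.-integrable setT (EFin \o (fun w => k w * gaussian_tilt u w)).
  by apply: integrable_test_functionM => //; exact: integrable_gaussian_tilt.
have -> : \int[gamma]_w k (u + w) = \int[gamma]_w (k w * gaussian_tilt u w).
  rewrite /Rintegral (@ge0_integral_gaussian_shift _ u (EFin \o k))//.
    exact/measurable_EFinP.
  by move=> x; rewrite lee_fin; case/andP: (k01 x).
have i1u : gamma.-integrable setT (EFin \o (fun w => k w * w * u)).
  by have := integrableZr measurableT u i1; apply: eq_integrable.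
have i2u : gamma.-integrable setT (EFin \o (fun w =>
  k w * ((w ^+ 2 - 1) / 2) * u ^+ 2)).
  by have := integrableZr measurableT (u ^+ 2) i2; apply: eq_integrable.
have i01 : gamma.-integrable setT (EFin \o (fun w => k w + k w * w * u)).
  by have := integrableD measurableT i0 i1u; apply: eq_integrable.
have i012 : gamma.-integrable setT
    (EFin \o (fun w => k w + k w * w * u + k w * ((w ^+ 2 - 1) / 2) * u ^+ 2)).
  by have := integrableD measurableT i01 i2u; apply: eq_integrable.
rewrite -RintegralZr// -RintegralZr// -RintegralD// -RintegralD// -RintegralB//.
have id : gamma.-integrable setT (EFin \o (fun w => k w * gaussian_tilt u w -
    (k w + k w * w * u + k w * ((w ^+ 2 - 1) / 2) * u ^+ 2))).
  by have := integrableB measurableT it i012; apply: eq_integrable.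
rewrite (le_trans (le_normr_Rintegral _ _))//.
have ib : gamma.-integrable setT (EFin \o (fun w =>
  gaussian_tilt u w + taylor_cst * tilt_envelope w)).
  have := integrableD measurableT (integrable_gaussian_tilt u)
    (integrableZl measurableT (taylor_cst : R) integrable_tilt_envelope).
  by apply: eq_integrable.
apply: (@le_trans _ _ (\int[gamma]_w (`|u| ^+ 3 * (gaussian_tilt u w +
  taylor_cst * tilt_envelope w)))).
  apply: le_Rintegral => //.
  - exact: integrable_norm.
  - by have := integrableZl measurableT (`|u| ^+ 3) ib; apply: eq_integrable.
  move=> w _.
  have -> : k w * gaussian_tilt u w -
      (k w + k w * w * u + k w * ((w ^+ 2 - 1) / 2) * u ^+ 2) =
      k w * (gaussian_tilt u w - (1 + w * u +
        (w ^+ 2 - 1) / 2 * u ^+ 2)) by ring.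
  rewrite normrM (le_trans _ (gaussian_tilt_taylor u w))//.
  by rewrite ler_piMl// test_function_normr_le1.
have izt : gamma.-integrable setT (EFin \o (fun w =>
  taylor_cst * tilt_envelope w)).
  have := integrableZl measurableT (taylor_cst : R) integrable_tilt_envelope.
  by apply: eq_integrable.
rewrite RintegralZl// RintegralD//; last exact: integrable_gaussian_tilt.
rewrite RintegralZl//; last exact: integrable_tilt_envelope.
by rewrite Rintegral_gaussian_tilt Rintegral_tilt_envelope mulrC [_ * 2]mulrC.
Qed.

(** A law with the mean and variance of the standard Gaussian one, for which the
expansion up to third order makes sense. *)
Definition standardized m :=
  [/\ m.-integrable setT (fun x => (`|x| ^+ 3)%:E),
      \int[m]_x x = 0 & \int[m]_x (x ^+ 2) = 1].

Definition third_moment m : R := \int[m]_x (`|x| ^+ 3).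

Lemma third_moment_ge0 m : 0 <= third_moment m.
Proof. by apply: Rintegral_ge0 => x _; rewrite exprn_ge0. Qed.

(** The expansion of [1 = \int gaussian_tilt u] in [u] determines the first two
moments. *)
Lemma standardized_gaussian : standardized (gaussian R).
Proof.
have t1 : test_function (cst 1 : R -> R) by split=> [|x];
  rewrite /= ?ler01 ?lexx.
set A := \int[gamma]_x x; set B := \int[gamma]_x ((x ^+ 2 - 1) / 2).
have AB u : `|A * u + B * u ^+ 2| <= smear_cst * `|u| ^+ 3.
  have := gaussian_shift_taylor u t1; rewrite /= !Rintegral_probability_cst.
  have -> : \int[gamma]_w (1 * w) = A by apply: eq_Rintegral => w _;
    rewrite mul1r.
  have -> : \int[gamma]_w (1 * ((w ^+ 2 - 1) / 2)) = B.
    by apply: eq_Rintegral => w _; rewrite mul1r.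
  rewrite distrC (_ : 1 + A * u + B * u ^+ 2 - 1 = A * u + B * u ^+ 2)//.
  by ring.
have C0 := @smear_cst_ge0.
(* a number that is [O(u)] as [u] tends to 0 vanishes; the odd and even parts of
   the expansion show that this is the case of [A] and [B] *)
have small0 (z : R) : (forall u, 0 < u <= 1 -> `|z| <= smear_cst * u) -> z = 0.
  move=> hz; apply/eqP; rewrite -normr_le0 leNgt; apply/negP => zpos.
  have D0 : 0 < 1 + smear_cst + `|z| by rewrite ltr_pwDr// addr_ge0.
  have := hz (`|z| / (1 + smear_cst + `|z|)).
  rewrite divr_gt0// ler_pdivrMr// mul1r lerDr addr_ge0// => /(_ isT).
  by rewrite mulrA ler_pdivlMr// mulrC ler_pM2r//
    leNgt -addrA -addrCA ltrDl ltr_pwDl.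
have ABu u : 0 < u <= 1 -> `|A| <= smear_cst * u /\ `|B| <= smear_cst * u.
  case/andP=> u0 u1; have h1 := AB u; have h2 := AB (- u).
  move: h1 h2; rewrite normrN (gtr0_norm u0) !ler_norml =>
    /andP[h1 h2] /andP[h3 h4].
  have uu : smear_cst * u ^+ 2 <= smear_cst * u.
    by rewrite ler_wpM2l// expr2 ler_piMl// ltW.
  split; apply/andP; split.
  - apply: (@le_trans _ _ (- (smear_cst * u ^+ 2))); first by rewrite lerN2.
    by rewrite -(ler_pM2r u0); lra.
  - apply: le_trans uu.
    by rewrite -(ler_pM2r u0); lra.
  - by rewrite -(ler_pM2r (exprn_gt0 2 u0)); lra.
  - by rewrite -(ler_pM2r (exprn_gt0 2 u0)); lra.
have A0 : A = 0 by apply: small0 => u /ABu[].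
have B0 : B = 0 by apply: small0 => u /ABu[].
split; [exact: integrable_gaussian_normX|exact: A0|].
have iq : gamma.-integrable setT (EFin \o (fun w : R => w ^+ 2 - 1)).
  have := integrableB measurableT (@integrable_gaussian_X R 2)
    (@integrable_gaussian_X R 0).
  by apply: eq_integrable => // w _ /=; rewrite -EFinB expr0.
move: B0; rewrite /B RintegralZr// RintegralB//; last 2 first.
- exact: integrable_gaussian_X.
- exact: finite_measure_integrable_cst.
rewrite Rintegral_probability_cst => /eqP.
by rewrite mulf_eq0 invr_eq0 pnatr_eq0 orbF subr_eq0 => /eqP.
Qed.

(** Rescaling: smearing [h] at scale [s] amounts to smearing a test function of
[x / s] at scale 1. *)
Lemma smear_gaussian_taylor (s : R) h y : 0 < s -> test_function h ->
  exists a b c, forall x,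
    `|smear gamma s h (y + x) - (a + b * x + c * x ^+ 2)| <=
    smear_cst / s ^+ 3 * `|x| ^+ 3.
Proof.
move=> s0 th; pose k w := h (y + s * w).
have tk : test_function k by exact: test_function_affine.
exists (\int[gamma]_w k w), (\int[gamma]_w (k w * w) / s),
  (\int[gamma]_w (k w * ((w ^+ 2 - 1) / 2)) / s ^+ 2) => x.
have sN0 : s != 0 by rewrite gt_eqF.
have -> : smear gamma s h (y + x) = \int[gamma]_w k (x / s + w).
  apply: eq_Rintegral => w _; rewrite /k; congr h.
  by rewrite mulrDr addrA mulrCA divff ?mulr1.
have -> : smear_cst / s ^+ 3 * `|x| ^+ 3 = smear_cst * `|x / s| ^+ 3.
  by rewrite normrM normfV (gtr0_norm s0); field.
apply: le_trans (gaussian_shift_taylor (x / s) tk).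
by rewrite le_eqVlt; apply/orP; left; apply/eqP; congr `|_ - _|; field.
Qed.

(** The polynomial of degree two in the expansion of [smear gamma s h] has the
same mean under [m] and under [gamma], so only the cubic errors remain. *)
Lemma smear_standardized m (s : R) h y : 0 < s -> test_function h ->
  standardized m ->
  `|smear m 1 (smear gamma s h) y - smear gamma 1 (smear gamma s h) y| <=
  smear_cst * (third_moment m + third_moment gamma) / s ^+ 3.
Proof.
move=> s0 th sm; have [a [b [c abc]]] := smear_gaussian_taylor y s0 th.
suff H m' : standardized m' ->
    `|smear m' 1 (smear gamma s h) y - (a + c)| <=
      smear_cst / s ^+ 3 * third_moment m'.
  apply: le_trans (ler_distD (a + c) _ _) _.
  rewrite [leRHS]mulrAC mulrDr lerD ?H// distrC H//.
  exact: standardized_gaussian.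
move=> {sm m} [i3 m1 m2].
have le1 (x : R) : `|x| <= 1 + `|x| ^+ 3.
  have [x1|x1] := leP `|x| 1; first by rewrite (le_trans x1)// lerDl exprn_ge0.
  by rewrite (@le_trans _ _ (`|x| ^+ 3))// ?lerDr// -[leLHS]expr1 ler_weXn2l//
    ltW.
have le2 (x : R) : `|x| ^+ 2 <= 1 + `|x| ^+ 3.
  have x0 := normr_ge0 x; have [x1|x1] := leP `|x| 1.
    by rewrite (@le_trans _ _ 1) ?exprn_ile1// lerDl exprn_ge0.
  by rewrite (@le_trans _ _ (`|x| ^+ 3))// ?lerDr// ler_weXn2l// ltW.
have i13 : m'.-integrable setT (EFin \o (fun x : R => 1 + `|x| ^+ 3)).
  have := integrableD measurableT (finite_measure_integrable_cst m' 1
    measurableT) i3.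
  by apply: eq_integrable.
have i1 : m'.-integrable setT (EFin \o (fun x : R => x)).
  apply: (le_integrable measurableT _ _ i13) => [|x _ /=].
    by apply/measurable_EFinP; exact: measurable_id.
  by rewrite lee_fin (le_trans (le1 x))// ler_norm.
have i2 : m'.-integrable setT (EFin \o (fun x : R => x ^+ 2)).
  apply: (le_integrable measurableT _ _ i13) => [|x _ /=].
    by apply/measurable_EFinP; apply: measurable_funX.
  by rewrite lee_fin normrX (le_trans (le2 x))// ler_norm.
have iG : m'.-integrable setT (EFin \o (fun x => smear gamma s h (y + 1 * x))).
  apply: integrable_test_function; apply: test_function_affine.
  exact: test_function_smear.
have ibx : m'.-integrable setT (EFin \o (fun x => b * x)).
  by have := integrableZl measurableT b i1; apply: eq_integrable.
have icx : m'.-integrable setT (EFin \o (fun x => c * x ^+ 2)).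
  by have := integrableZl measurableT c i2; apply: eq_integrable.
have ia : m'.-integrable setT (EFin \o (fun x : R => a)).
  exact: finite_measure_integrable_cst.
have iab : m'.-integrable setT (EFin \o (fun x => a + b * x)).
  by have := integrableD measurableT ia ibx; apply: eq_integrable.
have iabc : m'.-integrable setT (EFin \o (fun x => a + b * x + c * x ^+ 2)).
  by have := integrableD measurableT iab icx; apply: eq_integrable.
have -> : a + c = \int[m']_x (a + b * x + c * x ^+ 2).
  rewrite RintegralD// RintegralD// !RintegralZl// m1 m2.
  by rewrite Rintegral_probability_cst mulr0 addr0 mulr1.
rewrite /smear -RintegralB//.
have id : m'.-integrable setT (EFin \o (fun x =>
    smear gamma s h (y + 1 * x) - (a + b * x + c * x ^+ 2))).
  by have := integrableB measurableT iG iabc; apply: eq_integrable.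
rewrite (le_trans (le_normr_Rintegral _ _))// /third_moment -RintegralZl//.
apply: le_Rintegral => //; first exact: integrable_norm.
  by have := integrableZl measurableT (smear_cst / s ^+ 3) i3;
    apply: eq_integrable.
by move=> x _; rewrite mul1r abc.
Qed.

(** Lindeberg's replacement: the [n] summands of law [m] are exchanged one at a
time for Gaussian ones, and after smearing at scale [s] each exchange costs
[O(s ^- 3)] since two moments agree. *)
Lemma lindeberg m n (s : R) h y : 0 < s -> test_function h -> standardized m ->
  `|iter n (smear m 1) (smear gamma s h) y -
    smear gamma (Num.sqrt (n%:R + s ^+ 2)) h y| <=
  n%:R * (smear_cst * (third_moment m + third_moment gamma) / s ^+ 3).
Proof.
move=> s0 th sm; elim: n s s0 y => [|n ih] s s0 y.
  by rewrite /= add0r sqrtr_sqr (gtr0_norm s0) subrr normr0 mul0r.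
set K := smear_cst * _; pose s' := Num.sqrt (1 + s ^+ 2).
have q0 : 0 < 1 + s ^+ 2 by rewrite ltr_pwDl// sqr_ge0.
have s'0 : 0 < s' by rewrite sqrtr_gt0.
have ss' : s <= s'.
  by rewrite -[leLHS]gtr0_norm// -sqrtr_sqr ler_sqrt ?lerDr// ltW.
have K0 : 0 <= K.
  by apply: mulr_ge0; rewrite ?smear_cst_ge0// addr_ge0 ?third_moment_ge0.
rewrite iterSr.
apply: le_trans (ler_distD (iter n (smear m 1) (smear gamma s' h) y) _ _) _.
rewrite -natr1 mulrDl mul1r addrC lerD//; last first.
  apply: iter_smear_contraction => [||x].
  - by do 2 apply: test_function_smear.
  - exact: test_function_smear.
  rewrite -smear_gaussian_gaussian//.
  exact: smear_standardized.
have -> : Num.sqrt (n%:R + 1 + s ^+ 2) = Num.sqrt (n%:R + s' ^+ 2).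
  by rewrite /s' sqr_sqrtr ?ltW// addrA.
rewrite (le_trans (ih _ s'0 y))// ler_wpM2l// ler_wpM2l//.
by rewrite lef_pV2 ?posrE ?exprn_gt0// lerXn2r// ?nnegrE ltW.
Qed.

End lindeberg.

(** * Moments of a law with square integrable density *)

Section moments_of_square_integrable_density.
Context {R : realType}.
Local Notation gamma := (gaussian R).

(** By [2 a b <= a ^+ 2 + b ^+ 2] the moments of a law with square integrable
density are controlled by those of the Gaussian law. *)
Lemma integrable_normX_of_density_Lfun2 (m : probability R R) n :
  m `<< gamma -> density gamma m \in Lfun gamma 2%:E ->
  m.-integrable setT (fun x => (`|x| ^+ n)%:E).
Proof.
move=> mg fL2.
set f := density gamma m.
have f2 : gamma.-integrable setT (fun x => (`|f x| `^ 2)%:E).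
  by apply: Lfun_integrable => //; rewrite ler1n.
pose g := Radon_Nikodym_SigmaFinite.f m gamma.
have g0 : (forall x, 0 <= g x)%E := Radon_Nikodym_SigmaFinite.f_ge0 mg.
have mgf : measurable_fun setT g.
  exact: measurable_int (Radon_Nikodym_SigmaFinite.f_integrable mg).
have mX : measurable_fun setT (fun x : R => (`|x| ^+ n)%:E).
  by apply/measurable_EFinP; apply: measurable_funX.
have X0 (x : R) : (0 <= (`|x| ^+ n)%:E)%E by rewrite lee_fin exprn_ge0.
apply/integrableP; split => //.
rewrite (eq_integral (fun x : R => (`|x| ^+ n)%:E)); last first.
  by move=> x _; rewrite gee0_abs.
rewrite -(Radon_Nikodym_SigmaFinite.change_of_variables mg X0)// -/g.
have mR : measurable_fun setT (fun x : R => (`|x| ^+ (n + n))%:E).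
  by apply/measurable_EFinP; apply: measurable_funX.
have mf2 := measurable_int _ f2.
have h0 (x : R) : (0 <= (`|x| ^+ (n + n))%:E + (`|f x| `^ 2)%:E)%E.
  by rewrite adde_ge0// lee_fin ?exprn_ge0// powR_ge0.
apply: (@le_lt_trans _ _ (\int[gamma]_x ((`|x| ^+ (n + n))%:E +
  (`|f x| `^ 2)%:E))%E).
  apply: ae_ge0_le_integral => //.
  - by move=> x _; rewrite mule_ge0.
  - exact: emeasurable_funM.
  - exact: emeasurable_funD.
  have := ae_eq_Radon_Nikodym_SigmaFinite mg measurableT.
  apply: filterS => x /(_ I) + _; rewrite -/g => gx.
  have gf : g x = (f x)%:E.
    by rewrite gx /f /density/= fineK// Radon_Nikodym_fin_num.
  rewrite gf -EFinM -EFinD lee_fin.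
  have fx0 : 0 <= f x by rewrite -lee_fin -gf.
  rewrite (ger0_norm fx0) powR_mulrn// exprD.
  have := sqr_ge0 (`|x| ^+ n - f x).
  have : 0 <= `|x| ^+ n by rewrite exprn_ge0.
  by move: (`|x| ^+ n) => a; nra.
have := integrableD measurableT (@integrable_gaussian_normX R (n + n)) f2.
move=> /integrableP[_]; apply: le_lt_trans.
by rewrite le_eqVlt; apply/orP; left; apply/eqP; apply: eq_integral => x _;
  rewrite gee0_abs.
Qed.

Lemma standardized_distribution d (T : measurableType d) (P : probability T R)
    (X : {RV P >-> R}) :
  ('E_P[X] = 0)%E -> ('V_P[X] = 1)%E ->
  distribution P X `<< gamma ->
  density gamma (distribution P X) \in Lfun gamma 2%:E ->
  standardized (distribution P X).
Proof.
move=> EX VX dom fL2.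
have iX k := integrable_normX_of_density_Lfun2 k dom fL2.
split; first exact: iX.
  rewrite /Rintegral integral_distribution.
  - by rewrite -expectation_def EX.
  - by apply/measurable_EFinP; exact: measurable_id.
  - apply/integrableP; split; first by apply/measurable_EFinP;
      exact: measurable_funPT.
    have /integrableP[_] := iX 1%N; apply: le_lt_trans.
    rewrite ge0_integral_distribution//; last first.
      apply/measurableT_comp => //; apply/measurable_EFinP.
      exact: measurable_funX.
    rewrite le_eqVlt; apply/orP; left; apply/eqP; apply: eq_integral => x _ /=.
    by rewrite expr1 normr_id.
rewrite /Rintegral ge0_integral_distribution.
- have <- : fine 1%E = 1 :> R by [].
  rewrite -VX /variance unlock EX/= unlock; congr fine.
  apply: eq_integral => x _ /=.
  by rewrite -[RHS]/(((X x - 0) * (X x - 0))%:E) subr0 expr2.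
- by apply/measurable_EFinP; apply: measurable_funX.
- by move=> y; rewrite lee_fin sqr_ge0.
Qed.

End moments_of_square_integrable_density.

(** * Sums of independent variables *)

Section independent_sums.
Context d (T : measurableType d) (R : realType) (P : probability T R).
Local Notation gamma := (gaussian R).

Definition independent_pair (U V : {RV P >-> R}) :=
  forall A B : set R, measurable A -> measurable B ->
    (P (U @^-1` A `&` V @^-1` B) = P (U @^-1` A) * P (V @^-1` B))%E.

(** The joint law is the product law, so that the expectation over [V] can be
taken first. *)
Lemma Rintegral_independent_sum (U V : {RV P >-> R}) (s : R) (h : R -> R) :
  independent_pair U V -> test_function h ->
  \int[P]_t h (U t + s * V t) = \int[P]_t smear (distribution P V) s h (U t).
Proof.
move=> UV th; have [mh h01] := th.
have mW : measurable_fun setT (fun t => (U t, V t)).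
  by apply/measurable_fun_pairP; split; exact: measurable_funPT.
pose W : {mfun T >-> (R * R)%type} :=
  HB.pack (fun t => (U t, V t)) (isMeasurableFun.Build _ _ _ _ _ mW).
pose H (p : R * R) := (h (p.1 + s * p.2))%:E.
have mH : measurable_fun setT H.
  apply/measurable_EFinP; apply: measurableT_comp => //.
  by apply: measurable_funD => //; apply: measurable_funM.
have H0 p : (0 <= H p)%E by rewrite lee_fin; case/andP: (h01 (p.1 + s * p.2)).
congr fine.
transitivity (\int[distribution P W]_p H p)%E.
  by rewrite ge0_integral_distribution.
transitivity (\int[distribution P U \x distribution P V]_p H p)%E.
  apply: eq_measure_integral => A mA _; apply/esym.
  exact: product_measure_unique.
rewrite fubini_tonelli1//.
transitivity (\int[distribution P U]_x (smear (distribution P V) s h x)%:E)%E.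
  by apply: eq_integral => x _; rewrite smearE.
have [ms s01] := test_function_smear (distribution P V) s th.
rewrite ge0_integral_distribution//; first exact/measurable_EFinP.
by move=> x; rewrite lee_fin; case/andP: (s01 x).
Qed.

Section partial_sums.
Variable X : nat -> {RV P >-> R}.

Definition partial_sum n (t : T) : R := \sum_(i < n) X i t.

Let measurable_partial_sum n : measurable_fun setT (partial_sum n).
Proof. by apply: measurable_sum => i; exact: measurable_funPT. Qed.

HB.instance Definition _ n :=
  isMeasurableFun.Build _ _ _ _ (partial_sum n) (measurable_partial_sum n).

(** Independence of a variable from a family is known on the sigma-algebra that
the family generates; this brings the sums of the family into it. *)
Lemma partial_sum_measurable_wrt (G : set (set T)) n (C : set R) :
  (forall i (B : set R), (i < n)%N -> measurable B -> <<s G >> (X i @^-1` B)) ->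
  measurable C -> <<s G >> (partial_sum n @^-1` C).
Proof.
move=> XG mC.
have mS : measurable_fun (setT : set (g_sigma_algebraType G)) (partial_sum n).
  apply: measurable_sum => i; move=> _ B mB; rewrite setTI.
  exact: XG.
by have := mS measurableT C mC; rewrite setTI.
Qed.

(** For fixed [B], the finite measures [A |-> P (A `&` X n @^-1` B)] and
[A |-> P (X n @^-1` B) * P A] agree on the pi-system of finite intersections of
events on the first [n] variables, hence on the sigma-algebra it generates. *)
Lemma independent_partial_sum n : mutually_independent P X ->
  independent_pair [the {RV P >-> R} of partial_sum n] (X n).
Proof.
move=> indX A B mA mB.
pose G : set (set T) := [set C | exists2 D : nat -> set R,
  (forall i, measurable (D i)) & C = \bigcap_(i in `I_n) (X i @^-1` D i)].
have mX i D : measurable D -> measurable (X i @^-1` D).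
  by move=> mD; exact: measurable_funPTI.
have GX i (D : set R) : (i < n)%N -> measurable D -> G (X i @^-1` D).
  move=> ni mD; exists (fun j => if j == i then D else setT).
    by move=> j; case: ifP.
  apply/seteqP; split => [t Dt j _ /=|t /(_ i ni)/=]; last by rewrite eqxx.
  by case: ifP => // /eqP ->.
have mXB := mX n B mB.
pose m2 := mscale (NngNum (fine_ge0 (measure_ge0 P (X n @^-1` B)))) P.
suff: mrestr P mXB (partial_sum n @^-1` A) = m2 (partial_sum n @^-1` A).
  rewrite /mrestr/= => ->; rewrite /m2 /mscale/= fineK ?fin_num_measure//.
  exact: muleC.
apply: (g_sigma_algebra_measure_unique G _ (fun=> setT)) => //.
- move=> _ [D mD ->]; by apply: bigcap_measurableType => i _; exact: mX.
- move=> _; exists (fun=> setT) => //.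
  by apply/seteqP; split => t.
- by rewrite bigcup_const//; exists 0%N.
- move=> _ _ [D mD ->] [D' mD' ->]; exists (fun i => D i `&` D' i).
    by move=> i; exact: measurableI.
  by rewrite -bigcapI.
- move=> _ [D mD ->].
  pose J : {fset nat} := [fset i in iota 0 n]%fset.
  have JE i : (i \in J) = (i < n)%N by rewrite !inE/= mem_iota.
  have nJ : n \notin J by rewrite JE ltnn.
  pose E i := if i == n then B else D i.
  have En : E n = B by rewrite /E eqxx.
  have EJ i : i \in J -> E i = D i.
    by rewrite JE /E => ni; rewrite ltn_eqF.
  have mE i : measurable (E i) by rewrite /E; case: ifP.
  have setJ : [set` J] = `I_n by apply/seteqP; split => i /=; rewrite JE.
  have := indX (n |` J)%fset E (fun i _ => mE i).
  rewrite big_fsetU1//= En.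
  have -> : (\prod_(i <- J) P (X i @^-1` E i) =
    \prod_(i <- J) P (X i @^-1` D i))%E.
    by rewrite [LHS]big_seq [RHS]big_seq; apply: eq_bigr => i /EJ ->.
  rewrite -(indX J D (fun i _ => mD i)) setJ => PE.
  rewrite /mrestr /m2 /mscale/= fineK ?fin_num_measure// -PE; congr (P _).
  apply/seteqP; split => t.
    move=> [Dt Bt] i /=; rewrite in_fset1U => /orP[/eqP ->|iJ];
      first by rewrite En.
    have ni : (i < n)%N by rewrite -JE.
    by rewrite EJ//; exact: (Dt i ni).
  move=> Et; split; last by rewrite -En; apply: (Et n);
    rewrite /= in_fset1U eqxx.
  move=> i /= ni; have iJ : i \in J by rewrite JE.
  by rewrite -(EJ i iJ); apply: (Et i); rewrite /= in_fset1U iJ orbT.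
- move=> _; change (P (setT `&` X n @^-1` B) < +oo)%E.
  by rewrite setTI ltey_eq fin_num_measure.
- apply: partial_sum_measurable_wrt => // i D ni mD.
  by apply: sub_sigma_algebra; exact: GX.
Qed.

Lemma Rintegral_partial_sum n (h : R -> R) :
  mutually_independent P X -> identically_distributed P X -> test_function h ->
  \int[P]_t h (partial_sum n t) = iter n (smear (distribution P (X 0%N)) 1) h 0.
Proof.
move=> indX idX; elim: n h => [|n ih] h th.
  rewrite /= -[RHS](Rintegral_probability_cst P (h 0));
    apply: eq_Rintegral => t _.
  by rewrite /partial_sum big_ord0.
rewrite iterSr -ih; last exact: test_function_smear.
transitivity (\int[P]_t h (partial_sum n t + 1 * X n t)).
  by apply: eq_Rintegral => t _; rewrite /partial_sum big_ord_recr/= mul1r.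
rewrite (Rintegral_independent_sum 1 (independent_partial_sum n indX) th).
apply: eq_Rintegral => t _; congr fine.
by apply: eq_measure_integral => A mA _; exact: idX.
Qed.

Lemma Rintegral_partial_sum_gaussian n (Z : {RV P >-> R}) (s : R) (h : R -> R) :
  mutually_independent P X -> identically_distributed P X ->
  standard_gaussian Z -> independent_of_family P X Z -> test_function h ->
  \int[P]_t h (partial_sum n t + s * Z t) =
  iter n (smear (distribution P (X 0%N)) 1) (smear gamma s h) 0.
Proof.
move=> indX idX gZ indZ th.
rewrite -Rintegral_partial_sum//; last exact: test_function_smear.
have iZ : independent_pair [the {RV P >-> R} of partial_sum n] Z.
  move=> A B mA mB; apply: indZ => //.
  apply: partial_sum_measurable_wrt => // i D _ mD.
  apply: sub_sigma_algebra; exists i => //; exists D => //.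
  by rewrite setTI.
rewrite (Rintegral_independent_sum s iZ th).
apply: eq_Rintegral => t _; congr fine.
by apply: eq_measure_integral => A mA _; exact: gZ.
Qed.

End partial_sums.

End independent_sums.

(** * From total variation to the norm of the density *)

Section total_variation.
Local Open Scope charge_scope.
Context {R : realType}.
Local Notation gamma := (gaussian R).

Section density.
Variable m : probability R R.
Hypothesis dom : m `<< gamma.

Lemma EFin_density x :
  (density gamma m x)%:E = ('d (charge_of_finite_measure m) '/d gamma)%E x.
Proof. by rewrite /density/= fineK// Radon_Nikodym_fin_num. Qed.

Lemma integrable_density : gamma.-integrable setT (EFin \o density gamma m).
Proof.
rewrite (_ : _ \o _ = ('d (charge_of_finite_measure m) '/d gamma)%E).
  exact: Radon_Nikodym_integrable.
by apply/funext => x /=; rewrite EFin_density.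
Qed.

Lemma Rintegral_density (A : set R) : measurable A ->
  \int[gamma]_(x in A) density gamma m x = fine (m A).
Proof.
move=> mA; congr fine.
have -> : m A = charge_of_finite_measure m A by [].
rewrite (Radon_Nikodym_integral (nu := charge_of_finite_measure m) dom mA).
by apply: eq_integral => x _; rewrite EFin_density.
Qed.

(** The [L^1] distance of a density to [1] splits over the set where the density
exceeds [1] and its complement. *)
Lemma Lnorm_density_le (e : R) :
  (forall A : set R, measurable A -> `|fine (m A) - fine (gamma A)| <= e) ->
  (Lnorm gamma 1 (EFin \o (density gamma m \- cst 1)%R) <= (2 * e)%:E)%E.
Proof.
move=> me; set g := density gamma m.
have ig : gamma.-integrable setT (EFin \o g) by exact: integrable_density.
have i1 : gamma.-integrable setT (EFin \o (cst 1 : R -> R)).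
  exact: finite_measure_integrable_cst.
have igm : gamma.-integrable setT (EFin \o (g \- cst 1)).
  by have := integrableB measurableT ig i1; apply: eq_integrable.
have ign := integrable_norm igm.
rewrite Lnorm1.
have -> : (\int[gamma]_x `|(EFin \o (g \- cst 1)%R) x| =
    (\int[gamma]_x `|g x - 1|)%R%:E)%E.
  rewrite /Rintegral fineK; last exact: integrable_fin_num ign.
  exact: eq_integral.
pose A := [set x | 1 <= g x].
have mA : measurable A.
  rewrite (_ : A = setT `&` [set x | cst 1 x <= g x]); last by rewrite setTI.
  apply: measurable_fun_le => //.
  by apply/measurable_EFinP; exact: measurable_int ig.
have mAC : measurable (~` A) by exact: measurableC.
have iS B (f : R -> R) : measurable B -> gamma.-integrable setT (EFin \o f) ->
    gamma.-integrable B (EFin \o f).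
  by move=> mB; exact: (integrableS measurableT mB (subsetT _)).
rewrite lee_fin -(setUv A) Rintegral_setU//; last 2 first.
- by rewrite setUv.
- by apply/disj_setPCl.
rewrite (_ : 2 * e = e + e); last by ring.
have IB B : measurable B ->
    \int[gamma]_(x in B) (g x - 1) = fine (m B) - fine (gamma B).
  move=> mB; rewrite RintegralB//; [|exact: iS..].
  by rewrite Rintegral_density// Rintegral_cst// mul1r.
apply: lerD.
  rewrite (le_trans _ (me A mA))// -IB// (le_trans _ (ler_norm _))//.
  rewrite le_eqVlt; apply/orP; left; apply/eqP;
    apply: eq_Rintegral => x /set_mem Ax.
  by rewrite ger0_norm// subr_ge0.
rewrite (le_trans _ (me _ mAC))// -IB// -normrN (le_trans _ (ler_norm _))//.
suff -> : - (\int[gamma]_(x in ~` A) (g x - 1)) =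
  \int[gamma]_(x in ~` A) `|g x - 1| by [].
rewrite -[LHS]mulN1r -RintegralZl//; last exact: iS.
apply: eq_Rintegral => x /set_mem /= /negP; rewrite -ltNge => gx.
by rewrite mulN1r ltr0_norm// subr_lt0.
Qed.

End density.

End total_variation.

(** * The law of the smoothed sum *)

Section smoothed_sum_law.
Context d (T : measurableType d) (R : realType) (P : probability T R).
Variables (X : nat -> {RV P >-> R}) (Z : {RV P >-> R}) (b : nat -> R) (n : nat).
Hypotheses (n0 : (0 < n)%N) (b0 : 0 <= b n).
Local Notation gamma := (gaussian R).

Lemma smoothed_sumE t : smoothed_sum X Z b n t =
  (Num.sqrt (n%:R + b n))^-1 * (partial_sum X n t + Num.sqrt (b n) * Z t).
Proof.
have nR : 0 < n%:R :> R by rewrite ltr0n.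
have q0 : 0 < n%:R + b n by rewrite ltr_wpDr.
have sn0 : Num.sqrt n%:R != 0 :> R by rewrite gt_eqF// sqrtr_gt0.
have sq0 : Num.sqrt (n%:R + b n) != 0 by rewrite gt_eqF// sqrtr_gt0.
rewrite /smoothed_sum -/(partial_sum X n t) !sqrtrM// sqrtrV; last exact: ltW.
by field; rewrite sn0 sq0.
Qed.

Hypothesis indX : mutually_independent P X.
Hypothesis idX : identically_distributed P X.
Hypotheses (gZ : standard_gaussian Z) (indZ : independent_of_family P X Z).

Let r : R := (Num.sqrt (n%:R + b n))^-1.

Let r0 : 0 < r.
Proof. by rewrite invr_gt0 sqrtr_gt0 ltr_wpDr// ltr0n. Qed.

(* the term 0 puts the argument in the form [y + s * v] *)
Let scaled_indic (B : set R) (v : R) : R := \1_B (0 + r * v).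

Let test_scaled_indic B : measurable B -> test_function (scaled_indic B).
Proof.
move=> mB; apply: (@test_function_affine _ (\1_B : R -> R)); split => [|x].
  exact: measurable_indic.
by rewrite indicE; case: (x \in B); rewrite ?lexx ?ler01.
Qed.

Lemma Rintegral_indic_comp d' (T' : measurableType d') (m : probability T' R)
  (f : T' -> R) (B : set R) : measurable_fun setT f -> measurable B ->
  \int[m]_x (\1_B (f x) : R) = fine (m (f @^-1` B)).
Proof.
move=> mf mB; rewrite /Rintegral.
rewrite (_ : (fun x => _) = EFin \o \1_(f @^-1` B))//.
rewrite integral_indic ?setIT//.
by rewrite -[X in measurable X]setTI; exact: mf.
Qed.

Lemma distribution_smoothed_sum (B : set R) : measurable B ->
  fine (distribution P (smoothed_sum X Z b n) B) =
  iter n (smear (distribution P (X 0%N)) 1)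
    (smear gamma (Num.sqrt (b n)) (scaled_indic B)) 0.
Proof.
move=> mB; rewrite -(Rintegral_partial_sum_gaussian n (Num.sqrt (b n))
  indX idX gZ indZ (test_scaled_indic mB)).
transitivity (\int[P]_t (\1_B (smoothed_sum X Z b n t) : R)).
  by rewrite Rintegral_indic_comp//; exact: measurable_funPT.
by apply: eq_Rintegral => t _; rewrite /scaled_indic add0r smoothed_sumE.
Qed.

(** One summand with a density is enough, whatever is added to it independently;
when [b n = 0] the noise [Z] is absent and [X 0] has to play this role. *)
Lemma distribution_smoothed_sum_dominates :
  distribution P (X 0%N) `<< gamma ->
  distribution P (smoothed_sum X Z b n) `<< gamma.
Proof.
move=> /null_content_dominatesP dom; apply/null_content_dominatesP => B mB B0.
apply/eqP; rewrite -fine_eq0 ?fin_num_measure//.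
rewrite distribution_smoothed_sum//.
have affine0 (y s : R) : 0 < s ->
    \int[gamma]_x scaled_indic B (y + s * x) = 0.
  move=> s0; have mf := measurable_affine (r * y) (r * s).
  transitivity (\int[gamma]_x (\1_B (r * y + r * s * x) : R)).
    by apply: eq_Rintegral => x _; rewrite /scaled_indic add0r mulrDr mulrA.
  rewrite Rintegral_indic_comp//.
  exact: (congr1 fine (gaussian_preimage_affine_null (r * y) (mulr_gt0 r0 s0)
    mB B0)).
(* whether or not there is noise, adding one summand kills the null set *)
have step0 : smear (distribution P (X 0%N)) 1
    (smear gamma (Num.sqrt (b n)) (scaled_indic B)) = cst 0.
  apply/funext => y; rewrite /smear.
  have [s0|s0] := ltP 0 (Num.sqrt (b n)).
    rewrite -[RHS](Rintegral_probability_cst (distribution P (X 0%N)) 0).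
    by apply: eq_Rintegral => x _; exact: affine0.
  have {}s0 : Num.sqrt (b n) = 0 by apply/eqP; rewrite eq_le s0 sqrtr_ge0.
  transitivity (\int[distribution P (X 0%N)]_x (\1_B (r * y + r * x) : R)).
    apply: eq_Rintegral => x _; rewrite s0.
    rewrite -[RHS](Rintegral_probability_cst gamma).
    by apply: eq_Rintegral => z _; rewrite /scaled_indic add0r mul0r addr0 mul1r
      mulrDr.
  rewrite Rintegral_indic_comp//; last exact: measurable_affine.
  apply: (congr1 fine (dom _ _ (gaussian_preimage_affine_null (r * y)
    r0 mB B0))).
  by rewrite -[X in measurable X]setTI; exact: measurable_affine.
have iter0 k : iter k (smear (distribution P (X 0%N)) 1) (cst 0) =
  cst 0 :> (R -> R).
  elim: k => //= k ->; apply/funext => y.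
  exact: Rintegral_probability_cst.
by case: (n) n0 step0 => // k _ step0; rewrite iterSr step0 iter0.
Qed.

Lemma distribution_smoothed_sum_gaussian (B : set R) : measurable B ->
  0 < b n -> standardized (distribution P (X 0%N)) ->
  `|fine (distribution P (smoothed_sum X Z b n) B) - fine (gamma B)| <=
  n%:R * (smear_cst *
    (third_moment (distribution P (X 0%N)) + third_moment gamma) /
    Num.sqrt (b n) ^+ 3).
Proof.
move=> mB bn0 sX; rewrite distribution_smoothed_sum//.
have s0 : 0 < Num.sqrt (b n) by rewrite sqrtr_gt0.
have := lindeberg n 0 s0 (test_scaled_indic mB) sX.
have -> // : smear gamma (Num.sqrt (n%:R + Num.sqrt (b n) ^+ 2))
    (scaled_indic B) 0 = fine (gamma B).
rewrite sqr_sqrtr// /smear.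
transitivity (\int[gamma]_x (\1_B x : R)).
  apply: eq_Rintegral => x _; rewrite /scaled_indic !add0r mulrA /r mulVf
    ?mul1r//.
  by rewrite gt_eqF// sqrtr_gt0 ltr_wpDr// ltr0n.
by rewrite (@Rintegral_indic_comp _ _ gamma (fun x => x)).
Qed.

End smoothed_sum_law.

(** * Convergence *)

Lemma cube_sqrt_powR23 (R : realType) n :
  Num.sqrt (n%:R `^ (2 / 3) : R) ^+ 3 = n%:R.
Proof.
rewrite -powR12_sqrt ?powR_ge0// -powR_mulrn ?powR_ge0// -!powRrM.
by rewrite [X in _ `^ X](_ : _ = 1) ?powRr1//; field.
Qed.

(** This is where the exponent [2 / 3] enters: it makes the number [n] of
exchanges negligible against the gain [b ^ (3 / 2)] of each. *)
Lemma lindeberg_rate_le (R : realType) n (b : R) : (0 < n)%N ->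
  1 <= b / n%:R `^ (2 / 3) ->
  n%:R / Num.sqrt b ^+ 3 <= (b / n%:R `^ (2 / 3))^-1.
Proof.
move=> n0; set c := n%:R `^ (2 / 3); set q := b / c => q1.
have c0 : 0 < c by rewrite powR_gt0// ltr0n.
have q0 : 0 < q by rewrite (lt_le_trans _ q1).
have -> : b = q * c by rewrite /q divfK// gt_eqF.
have sc0 : 0 < Num.sqrt c by rewrite sqrtr_gt0.
rewrite sqrtrM ?(ltW q0)// exprMn /c cube_sqrt_powR23 -/c invfM mulrCA divff.
  rewrite mulr1 lef_pV2 ?posrE ?exprn_gt0 ?sqrtr_gt0//
    exprSr sqr_sqrtr ?(ltW q0)//.
  by rewrite ler_peMr ?(ltW q0)// -[leLHS]sqrtr1 ler_sqrt ?(ltW q0).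
by rewrite pnatr_eq0 -lt0n.
Qed.

Theorem theorem2p3 (R : realType) (d : measure_display) (T : measurableType d)
    (P : probability T R) (X : nat -> {RV P >-> R}) (Z : {RV P >-> R}) :
  mutually_independent P X ->
  identically_distributed P X ->
  (forall i, 'E_P[X i] = 0)%E ->
  (forall i, 'V_P[X i] = 1)%E ->
  distribution P (X 0%N) `<< gaussian R ->
  density (gaussian R) (distribution P (X 0%N)) \in Lfun (gaussian R) 2%:E ->
  standard_gaussian Z ->
  independent_of_family P X Z ->
  forall b : nat -> R,
  (forall n, (0 < n)%N -> 0 <= b n) ->
  b n / n%:R @[n --> \oo] --> 0 ->
  b n / (n%:R `^ (2 / 3)) @[n --> \oo] --> +oo ->
  (forall n, (0 < n)%N ->
     distribution P (smoothed_sum X Z b n) `<< gaussian R /\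
     density (gaussian R) (distribution P (smoothed_sum X Z b n))
       \in Lfun (gaussian R) 1) /\
  Lnorm (gaussian R) 1 (EFin \o
      (density (gaussian R) (distribution P (smoothed_sum X Z b n)) \- cst 1))
    @[n --> \oo] --> 0%E.
Proof.
move=> indX idX EX VX dom fL2 gZ indZ b b0 _ bn.
have sX := standardized_distribution (EX 0%N) (VX 0%N) dom fL2.
have domS n : (0 < n)%N -> distribution P (smoothed_sum X Z b n) `<< gaussian R.
  by move=> n0; apply: distribution_smoothed_sum_dominates => //; exact: b0.
split.
  move=> n n0; split; first exact: domS.
  by apply/Lfun1_integrable; exact/integrable_density/domS.
pose K := smear_cst * (third_moment (distribution P (X 0%N)) +
  third_moment (gaussian R)).
(* the error [K * n / sqrt b ^+ 3] is at most [K / q n] once [q n >= 1] *)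
pose q n := b n / n%:R `^ (2 / 3).
have qV : (2 * (K * (q n)^-1)) @[n --> \oo] --> 0.
  rewrite -[X in _ --> X](mulr0 2) -[X in 2 * X](mulr0 K).
  apply: cvgMl_tmp; apply: cvgMl_tmp.
  apply/(@gtr0_cvgV0 _ _ _ _ q) => //.
  by move/cvgryPgt : bn; apply.
apply: (squeeze_cvge (f := cst 0%E) (h := fun n => (2 * (K * (q n)^-1))%:E)).
- near=> n.
  have n0 : (0 < n)%N by near: n; exact: nbhs_infty_gt.
  have q1 : 1 <= q n by near: n; move/cvgryPge : bn; apply.
  have bn0 : 0 < b n.
    rewrite -(@pmulr_lgt0 _ (n%:R `^ (2 / 3))^-1) ?(lt_le_trans ltr01 q1)//.
    by rewrite invr_gt0 powR_gt0// ltr0n.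
  rewrite Lnorm_ge0/=.
  apply: Lnorm_density_le => [|A mA]; first exact: domS.
  apply: le_trans (distribution_smoothed_sum_gaussian n0 (ltW bn0)
    indX idX gZ indZ mA bn0 sX) _.
  rewrite -/K mulrCA ler_wpM2l ?lindeberg_rate_le//.
  by rewrite mulr_ge0 ?smear_cst_ge0// addr_ge0 ?third_moment_ge0.
- exact: cvg_cst.
- by apply: cvg_EFin; [near=> n|exact: qV].
Unshelve. all: by end_near.
Qed.
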